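(* The correspondence $X\mapsto\phi_X$, $\mu\mapsto\mu^*$ is a fully faithful contravariant functor from the category of 1-dimensional tropical fans (in $\mathbb R^n$, $n\ge1$ varying) to the category whose objects are the realizable homomorphisms and whose morphisms are the geometric morphisms.
   Context: Semirings have $0$ (absorbing) and $1$; homomorphisms preserve both. $\mathbb B=\{-\infty,0\}$ is the Boolean semifield with $\oplus=\max$, $\odot=+$. $\mathbb B[x^{\pm}]=\mathbb B[x_1^{\pm},\dots,x_n^{\pm}]$ is the semiring of Boolean Laurent polynomials $P=\bigoplus_{u}a_u\odot x^u$ ($u\in\mathbb Z^n$, $a_u\in\mathbb B$, $a_u=-\infty$ for all but finitely many $u$), with value $P(q)=\max_u\{a_u+u\cdot q\}$ at $q\in\mathbb R^n$. $\mathbb B[x^{\pm}]_{\mathrm{fcn}}$ is its quotient by the congruence identifying polynomials with the same values on all of $\mathbb R^n$; elements are regarded as functions on $\mathbb R^n$; $[P]$ is the class of $P$. Fans: a rational ray in $\mathbb R^n$ is a set $\{td: t\ge0\}$ with $d\in\mathbb Z^n\smallsetminus\{0\}$; its primitive direction vector is the unique primitive integer vector spanning it. A 1-dimensional tropical fan $X=(X,\omega_X)$ in $\mathbb R^n$ is a set $X=\{\{0\},\rho_1,\dots,\rho_r\}$ ($r\ge1$, $\rho_i$ distinct rational rays), with $X(1)=\{\rho_1,\dots,\rho_r\}$ and weights $\omega_X:X(1)\to\mathbb Z_{>0}$, such that $\sum_{\rho\in X(1)}w_\rho d_\rho=0$, where $w_\rho=\omega_X(\rho)$ and $d_\rho$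 is the primitive direction vector of $\rho$. $|X|$ is the union of its rays. A morphism $\mu:X\to Y$ of 1-dimensional tropical fans $X\subset\mathbb R^n$, $Y\subset\mathbb R^m$ is a map $|X|\to|Y|$ which is the restriction of a linear map $\mu_0:\mathbb R^n\to\mathbb R^m$ given by an integer matrix. For a finite set $A$ and $F\in\mathbb Z^A$ put $\deg F=\sum_{a\in A}F(a)$, $\mathbb Z^A_{\mathrm{pos}}=\{F\in\mathbb Z^A:\deg F\ge0\}$. $\mathbb Z^A_{\mathrm{pos}}\cup\{-\infty\}$ is a semiring under pointwise max ($\oplus$) and pointwise $+$ ($\odot$), where $-\infty$ is the constant map $-\infty$. $\phi_X:\mathbb B[x^{\pm}]_{\mathrm{fcn}}\to\mathbb Z^{X(1)}_{\mathrm{pos}}\cup\{-\infty\}$ is the semiring homomorphism $\phi_X(f)(\rho)=w_\rho f(d_\rho)$. A homomorphism $\phi:\mathbb B[x_1^\pm,\dots,x_n^\pm]_{\mathrm{fcn}}\to\mathbb Z^A_{\mathrm{pos}}\cup\{-\infty\}$ ($A$ finite) is realizable if there are a 1-dimensional tropical fan $X$ in $\mathbb R^n$ and a bijection $\sigma:A\to X(1)$ with $\phi(f)=\phi_X(f)\circ\sigma$ for all $f$. A morphism $\nu:\phi\to\psi$ of realizable homomorphisms is a semiring homomorphism $\nu:\mathrm{Im}(\phi)\to\mathrm{Im}(\psi)$. For realizable $\phi_1:\mathbb B[x_1^\pm,\dots,x_n^\pm]_{\mathrm{fcn}}\to\mathbb Z^A_{\mathrm{pos}}\cup\{-\infty\}$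 and $\phi_2$ with target $\mathbb Z^B_{\mathrm{pos}}\cup\{-\infty\}$, a morphism $\nu:\phi_1\to\phi_2$ is geometric if, with $F_i=\phi_1([x_i])$, for every $b\in B$ there exist $a\in A$ and a rational $t\ge0$ such that $\nu(F_i)(b)=tF_i(a)$ for all $i=1,\dots,n$. For a morphism $\mu:X\to Y$, restriction of a linear map $\mu_0$, the morphism $\mu^*:\phi_Y\to\phi_X$ is the homomorphism $\mathrm{Im}(\phi_Y)\to\mathrm{Im}(\phi_X)$, $\phi_Y(f)\mapsto\phi_X(f\circ\mu_0)$. *)

(* Defs.v *)
From HB Require Import structures.
From mathcomp Require Import all_boot all_order all_algebra finmap generic_quotient.
From mathcomp Require Import boolp classical_sets reals constructive_ereal.

Set Implicit Arguments.
Unset Strict Implicit.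
Unset Printing Implicit Defensive.

Import Order.TTheory GRing.Theory Num.Theory.
Local Open Scope ring_scope.

(* Tropical semirings are given MathComp's semiring structure, so the ring    *)
(* notation must be read tropically: [x + y] is the maximum, [x * y] is the   *)
(* ordinary sum, [0] is minus infinity and [1] is the real number zero.       *)
(* {rmorphism _ -> _} preserves [0], [1], [+] and [*].                        *)

Variant boolean_semifield := BNInf | BZero.

Notation "'𝔹'" := boolean_semifield.

Definition is_BZero (a : 𝔹) : bool := if a is BZero then true else false.
Definition bool_B (b : bool) : 𝔹 := if b then BZero else BNInf.

Lemma is_BZeroK : cancel is_BZero bool_B.
Proof. by case. Qed.

HB.instance Definition _ := Countable.copy 𝔹 (can_type is_BZeroK).

Definition B_max (a b : 𝔹) : 𝔹 := if a is BZero then BZero else b.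
Definition B_plus (a b : 𝔹) : 𝔹 := if a is BZero then b else BNInf.

Lemma B_maxA : associative B_max. Proof. by case; case; case. Qed.
Lemma B_maxC : commutative B_max. Proof. by case; case. Qed.
Lemma B_max0 : left_id BNInf B_max. Proof. by case. Qed.

HB.instance Definition _ := GRing.isNmodule.Build 𝔹 B_maxA B_maxC B_max0.

Lemma B_plusA : associative B_plus. Proof. by case; case; case. Qed.
Lemma B_plusC : commutative B_plus. Proof. by case; case. Qed.
Lemma B_plus1 : left_id BZero B_plus. Proof. by case. Qed.
Lemma B_plusDl : left_distributive B_plus B_max. Proof. by case; case; case. Qed.
Lemma B_plus0 : left_zero BNInf B_plus. Proof. by []. Qed.
Lemma BZero_neq : BZero != BNInf. Proof. by []. Qed.

HB.instance Definition _ := GRing.Nmodule_isComNzSemiRing.Build 𝔹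
  B_plusA B_plusC B_plus1 B_plusDl B_plus0 BZero_neq.

Lemma B_neq0 (a : 𝔹) : a != 0 -> a = 1. Proof. by case: a. Qed.
Lemma B_eqP (a b : 𝔹) : (a = 1 <-> b = 1) -> a = b.
Proof. by case: a; case: b => // -[h1 h2]; [have := h2 erefl | have := h1 erefl]. Qed.
Lemma B_add1 (a b : 𝔹) : a + b = 1 <-> a = 1 \/ b = 1.
Proof. by case: a; case: b; split => //; intuition. Qed.
Lemma B_mul1 (a b : 𝔹) : a * b = 1 <-> a = 1 /\ b = 1.
Proof. by case: a; case: b; split => // -[]. Qed.
Lemma B_sum1 (I : eqType) (r : seq I) (F : I -> 𝔹) :
  \sum_(i <- r) F i = 1 <-> exists2 i, i \in r & F i = 1.
Proof.
elim: r => [|i r IH]; first by rewrite big_nil; split => [|[]].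
rewrite big_cons; split => [/B_add1 [Fi|/IH [j jr Fj]]|[j]].
- by exists i => //; rewrite mem_head.
- by exists j => //; rewrite in_cons jr orbT.
- rewrite in_cons => /orP [/eqP ->|jr] Fj; apply/B_add1; first by left.
  by right; apply/IH; exists j.
Qed.

Section LaurentPolynomials.
Variable n : nat.

Record laurent := Laurent { lcoef :> {fsfun 'rV[int]_n -> 𝔹 with 0} }.

HB.instance Definition _ := [isNew for lcoef].
HB.instance Definition _ := [Choice of laurent by <:].

Implicit Types (P Q T : laurent) (u v w : 'rV[int]_n).

Definition lsupp P : {fset 'rV[int]_n} := finsupp (lcoef P).

Lemma laurentP P Q : (forall u, P u = Q u) -> P = Q.
Proof. by case: P Q => [p] [q] h; congr Laurent; apply/fsfunP. Qed.

Lemma lsuppP P u : reflect (P u = 1) (u \in lsupp P).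
Proof.
rewrite mem_finsupp; apply: (iffP idP) => [|->] //; exact: B_neq0.
Qed.

Definition lzero : laurent := Laurent [fsfun].
Definition lmonomial u : laurent := Laurent [fsfun [fsfun] with u |-> 1].
Definition ladd P Q : laurent :=
  Laurent [fsfun u in (lsupp P `|` lsupp Q)%fset => P u + Q u].
Definition lmul P Q : laurent :=
  Laurent [fsfun w in [fset (u + v)%R | u in lsupp P, v in lsupp Q]%fset =>
    \sum_(u <- lsupp P) P u * Q (w - u)].

Lemma lzeroE u : lzero u = 0.
Proof. by rewrite fsfunE. Qed.
Lemma lmonomialE u v : lmonomial u v = if v == u then 1 else 0.
Proof. by rewrite fsfun_withE fsfunE. Qed.
Lemma laddE P Q u : ladd P Q u = P u + Q u.
Proof.
rewrite fsfunE in_fsetU !mem_finsupp; case: (P u); case: (Q u) => //.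
Qed.
Lemma lmulE P Q w : lmul P Q w = \sum_(u <- lsupp P) P u * Q (w - u).
Proof.
rewrite fsfunE; case: ifP => // /negP h; apply/esym/eqP/negP => /negP /B_neq0.
move/B_sum1 => [u uP /B_mul1 [_ Qw]]; apply: h; apply/imfset2P.
by exists u => //; exists (w - u); [apply/lsuppP | rewrite addrC subrK].
Qed.

Lemma lmul1P P Q w : lmul P Q w = 1 <-> exists2 u, P u = 1 & Q (w - u) = 1.
Proof.
rewrite lmulE; split => [/B_sum1 [u _ /B_mul1 [Pu Qu]]|[u Pu Qu]].
  by exists u.
by apply/B_sum1; exists u; [apply/lsuppP | apply/B_mul1].
Qed.

Lemma laddA : associative ladd.
Proof. by move=> P Q T; apply: laurentP => u; rewrite !laddE addrA. Qed.
Lemma laddC : commutative ladd.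
Proof. by move=> P Q; apply: laurentP => u; rewrite !laddE addrC. Qed.
Lemma ladd0 : left_id lzero ladd.
Proof. by move=> P; apply: laurentP => u; rewrite laddE lzeroE add0r. Qed.

HB.instance Definition _ := GRing.isNmodule.Build laurent laddA laddC ladd0.

Lemma lmulC : commutative lmul.
Proof.
move=> P Q; apply: laurentP => w; apply: B_eqP.
by split=> /lmul1P [u Pu Qu]; apply/lmul1P; exists (w - u); rewrite // subKr.
Qed.
Lemma lmulA : associative lmul.
Proof.
move=> P Q T; apply: laurentP => w; apply: B_eqP; split.
  move=> /lmul1P [u Pu /lmul1P [v Qv Tv]]; apply/lmul1P; exists (u + v).
    by apply/lmul1P; exists u; rewrite // addrAC subrr add0r.
  by rewrite opprD addrA.
move=> /lmul1P [u /lmul1P [v Pv Qu] Tu]; apply/lmul1P; exists v => //.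
apply/lmul1P; exists (u - v) => //.
by rewrite opprB addrA subrK.
Qed.
Lemma lmul1 : left_id (lmonomial 0) lmul.
Proof.
move=> P; apply: laurentP => w; apply: B_eqP; split.
  move=> /lmul1P [u]; rewrite lmonomialE; case: eqP => // -> _.
  by rewrite subr0.
by move=> Pw; apply/lmul1P; exists 0; rewrite ?subr0 // lmonomialE eqxx.
Qed.
Lemma lmulDl : left_distributive lmul ladd.
Proof.
move=> P Q T; apply: laurentP => w; apply: B_eqP; split.
  move=> /lmul1P [u]; rewrite !laddE => /B_add1 [] h Tu; apply/B_add1; [left|right];
  by apply/lmul1P; exists u.
rewrite laddE => /B_add1 [] /lmul1P [u h Tu]; apply/lmul1P; exists u => //;
by rewrite laddE; apply/B_add1; [left + right].
Qed.
Lemma lmul0 : left_zero lzero lmul.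
Proof.
move=> P; apply: laurentP => w; apply: B_eqP; split.
  by move=> /lmul1P [u]; rewrite lzeroE.
by rewrite lzeroE.
Qed.
Lemma lone_neq0 : lmonomial 0 != lzero.
Proof.
apply/eqP => h; have := lmonomialE 0 0.
by rewrite h lzeroE eqxx.
Qed.

HB.instance Definition _ := GRing.Nmodule_isComNzSemiRing.Build laurent
  lmulA lmulC lmul1 lmulDl lmul0 lone_neq0.

End LaurentPolynomials.

Section Functions.
Variables (R : realType) (n : nat).
Implicit Types (P Q : laurent n) (u v : 'rV[int]_n) (q : 'rV[R]_n).

Definition B_val (a : 𝔹) : \bar R := if a is BZero then 0%:E else -oo%E.
Definition dot u q : R := \sum_i (u 0 i)%:~R * q 0 i.

(* Restricting the maximum to the (finite) support of [P] does not change it, *)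
(* the other terms being minus infinity.                                      *)
Definition leval P q : \bar R :=
  \big[maxe/-oo%E]_(u <- lsupp P) (B_val (P u) + (dot u q)%:E)%E.

Lemma dotD u v q : dot (u + v) q = dot u q + dot v q.
Proof.
by rewrite -big_split; apply: eq_bigr => i _; rewrite mxE rmorphD mulrDl.
Qed.

Lemma dot0 q : dot 0 q = 0.
Proof. by apply: big1 => i _; rewrite mxE mul0r. Qed.

Lemma leval_leP P q (y : \bar R) :
  (leval P q <= y)%E <-> (forall u, P u = 1 -> ((dot u q)%:E <= y)%E).
Proof.
split=> [le_y u Pu|le_y].
  apply: le_trans le_y; apply: (bigmax_sup_seq _ u); rewrite ?Pu ?add0e //.
  exact/lsuppP.
rewrite /leval big_seq; apply: bigmax_le => [|u /lsuppP Pu]; first exact: leNye.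
by rewrite Pu add0e; apply: le_y.
Qed.

Lemma leval_ge P q u : P u = 1 -> ((dot u q)%:E <= leval P q)%E.
Proof. by move: u; apply/leval_leP. Qed.

Lemma leval_attained P q :
  P = 0 \/ exists2 u, P u = 1 & leval P q = (dot u q)%:E.
Proof.
have [->|/eqP nz] := eqVneq P 0; [by left | right].
have [u0 Pu0] : exists u, P u = 1.
  apply: contrapT => h; apply: nz; apply: laurentP => u; rewrite lzeroE.
  by apply: contrapT => /eqP /B_neq0 Pu; apply: h; exists u.
apply: contrapT => h.
have {}h u : P u = 1 -> ((dot u q)%:E < leval P q)%E.
  move=> Pu; rewrite lt_neqAle leval_ge // andbT; apply/eqP => e.
  by apply: h; exists u.
suff : (leval P q < leval P q)%E by rewrite ltxx.
rewrite {1}/leval big_seq; apply: bigmax_lt => [|u /lsuppP Pu].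
  by apply: le_lt_trans (h _ Pu0); apply: leNye.
by rewrite Pu add0e; apply: h.
Qed.

Lemma leval0 q : leval 0 q = -oo%E.
Proof.
by apply/eqP; rewrite -leeNy_eq; apply/leval_leP => u; rewrite lzeroE.
Qed.

Lemma leval_monomial u q : leval (lmonomial u) q = (dot u q)%:E.
Proof.
apply/eqP; rewrite eq_le; apply/andP; split; last first.
  by apply: leval_ge; rewrite lmonomialE eqxx.
by apply/leval_leP => v; rewrite lmonomialE; case: eqP => [->|].
Qed.

Lemma levalD P Q q : leval (P + Q) q = maxe (leval P q) (leval Q q).
Proof.
apply/eqP; rewrite eq_le; apply/andP; split.
  apply/leval_leP => u; rewrite laddE le_max => /B_add1 [] h.
    by rewrite leval_ge.
  by rewrite orbC leval_ge.
rewrite ge_max; apply/andP; split; apply/leval_leP => u h; apply: leval_ge;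
by rewrite laddE; apply/B_add1; tauto.
Qed.

Lemma levalM P Q q : leval (P * Q) q = (leval P q + leval Q q)%E.
Proof.
have [->|[u Pu eP]] := leval_attained P q; first by rewrite mul0r leval0 addNye.
have [->|[v Qv eQ]] := leval_attained Q q; first by rewrite mulr0 leval0 addeNy.
apply/eqP; rewrite eq_le; apply/andP; split.
  apply/leval_leP => w /lmul1P [x Px Qx].
  by rewrite -(subrK x w) addrC dotD EFinD leeD // leval_ge.
rewrite eP eQ -EFinD -dotD; apply: leval_ge; apply/lmul1P; exists u => //.
by rewrite addrC addKr.
Qed.

Lemma leval1 q : leval 1 q = 0%:E.
Proof. by rewrite leval_monomial dot0. Qed.

Definition same_values P Q : bool := `[< forall q, leval P q = leval Q q >].

Lemma same_values_refl : reflexive same_values.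
Proof. by move=> P; apply/asboolP. Qed.
Lemma same_values_sym : symmetric same_values.
Proof. by move=> P Q; apply/asboolP/asboolP => h q; rewrite h. Qed.
Lemma same_values_trans : transitive same_values.
Proof.
move=> P Q T /asboolP h1 /asboolP h2; apply/asboolP => q.
by rewrite h1 h2.
Qed.

Canonical same_values_equiv :=
  EquivRel same_values same_values_refl same_values_sym same_values_trans.

Definition fcn := {eq_quot same_values}%qT.

HB.instance Definition _ := Choice.on fcn.
HB.instance Definition _ := EqQuotient.on fcn.

Definition fclass P : fcn := \pi_fcn%qT P.
Definition feval (f : fcn) : 'rV[R]_n -> \bar R := leval (repr f).

Lemma fclass_eq P Q : (fclass P = fclass Q) <-> leval P =1 leval Q.
Proof.
split=> [/eqP|h]; last by apply/eqP; rewrite /fclass eqmodE; apply/asboolP.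
by rewrite /fclass eqmodE => /asboolP.
Qed.

Lemma feval_class P : feval (fclass P) =1 leval P.
Proof. by apply/fclass_eq; rewrite /fclass reprK. Qed.

Lemma fclassK (f : fcn) : fclass (repr f) = f.
Proof. exact: reprK. Qed.

Lemma fevalP (f g : fcn) : feval f =1 feval g -> f = g.
Proof. by move=> h; rewrite -(fclassK f) -(fclassK g); apply/fclass_eq. Qed.

Definition fadd (f g : fcn) : fcn := fclass (repr f + repr g).
Definition fmul (f g : fcn) : fcn := fclass (repr f * repr g).

Lemma fclassD P Q : fclass (P + Q) = fadd (fclass P) (fclass Q).
Proof.
by apply/fclass_eq => q; rewrite !levalD -!/(feval _ _) !feval_class.
Qed.
Lemma fclassM P Q : fclass (P * Q) = fmul (fclass P) (fclass Q).
Proof.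
by apply/fclass_eq => q; rewrite !levalM -!/(feval _ _) !feval_class.
Qed.

Lemma faddA : associative fadd.
Proof.
by move=> f g h; rewrite -[f]fclassK -[g]fclassK -[h]fclassK -!fclassD addrA.
Qed.
Lemma faddC : commutative fadd.
Proof. by move=> f g; rewrite -[f]fclassK -[g]fclassK -!fclassD addrC. Qed.
Lemma fadd0 : left_id (fclass 0) fadd.
Proof. by move=> f; rewrite -[f]fclassK -fclassD add0r. Qed.

HB.instance Definition _ := GRing.isNmodule.Build fcn faddA faddC fadd0.

Lemma fmulA : associative fmul.
Proof.
by move=> f g h; rewrite -[f]fclassK -[g]fclassK -[h]fclassK -!fclassM mulrA.
Qed.
Lemma fmulC : commutative fmul.
Proof. by move=> f g; rewrite -[f]fclassK -[g]fclassK -!fclassM mulrC. Qed.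
Lemma fmul1 : left_id (fclass 1) fmul.
Proof. by move=> f; rewrite -[f]fclassK -fclassM mul1r. Qed.
Lemma fmulDl : left_distributive fmul fadd.
Proof.
move=> f g h; rewrite -[f]fclassK -[g]fclassK -[h]fclassK.
by rewrite -fclassD -!fclassM -fclassD mulrDl.
Qed.
Lemma fmul0 : left_zero (fclass 0) fmul.
Proof. by move=> f; rewrite -[f]fclassK -fclassM mul0r. Qed.
Lemma fone_neq0 : fclass 1 != fclass 0.
Proof.
by apply/eqP => /fclass_eq /(_ 0); rewrite leval1 leval0.
Qed.

HB.instance Definition _ := GRing.Nmodule_isComNzSemiRing.Build fcn
  fmulA fmulC fmul1 fmulDl fmul0 fone_neq0.

Lemma fclass_nmod : nmod_morphism fclass.
Proof. by split=> // P Q; apply: fclassD. Qed.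
Lemma fclass_monoid : monoid_morphism fclass.
Proof. by split=> // P Q; apply: fclassM. Qed.

HB.instance Definition _ :=
  GRing.isNmodMorphism.Build (laurent n) fcn fclass fclass_nmod.
HB.instance Definition _ :=
  GRing.isMonoidMorphism.Build (laurent n) fcn fclass fclass_monoid.

Lemma feval0 q : feval 0 q = -oo%E.
Proof. by rewrite feval_class leval0. Qed.
Lemma feval1 q : feval 1 q = 0%:E.
Proof. by rewrite feval_class leval1. Qed.
Lemma fevalD f g q : feval (f + g) q = maxe (feval f q) (feval g q).
Proof. by rewrite feval_class levalD. Qed.
Lemma fevalM f g q : feval (f * g) q = (feval f q + feval g q)%E.
Proof. by rewrite feval_class levalM. Qed.

Definition lvar (i : 'I_n) : laurent n := lmonomial (delta_mx 0 i).

End Functions.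

Notation intmx R := (map_mx (intr : int -> R)).

Section LinearSubstitution.
Variables (R : realType) (n m : nat) (M : 'M[int]_(n, m)).

(* Matrices act on row vectors, on the right: [q |-> q *m M], so the monomial *)
(* with exponent [u] pulls back to the monomial with exponent [u *m M^T].     *)
Definition lsubst (P : laurent m) : laurent n :=
  \sum_(u <- lsupp P) lmonomial (u *m M^T).

Definition fsubst (f : fcn R m) : fcn R n := fclass R (lsubst (repr f)).

Lemma dot_mulmx (u : 'rV[int]_m) (q : 'rV[R]_n) :
  dot u (q *m intmx R M) = dot (u *m M^T) q.
Proof.
rewrite /dot; under eq_bigr => j _ do rewrite mxE mulr_sumr.
rewrite exchange_big; apply: eq_bigr => i _.
rewrite mxE rmorph_sum mulr_suml; apply: eq_bigr => j _.
by rewrite !mxE rmorphM /= -mulrA [q 0 i * _]mulrC.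
Qed.

Lemma leval_subst P (q : 'rV[R]_n) :
  leval (lsubst P) q = leval P (q *m intmx R M).
Proof.
rewrite /lsubst (big_morph (fun Q => leval Q q) (fun Q1 Q2 => levalD Q1 Q2 q)
  (leval0 q)).
apply: eq_big_seq => u /lsuppP Pu.
by rewrite leval_monomial Pu add0e dot_mulmx.
Qed.

Lemma feval_subst f (q : 'rV[R]_n) :
  feval (fsubst f) q = feval f (q *m intmx R M).
Proof. by rewrite feval_class leval_subst. Qed.

End LinearSubstitution.

Definition zdeg (A : finType) (F : {ffun A -> int}) : int := \sum_a F a.

Definition zfun_pos (A : finType) := {F : {ffun A -> int} | 0 <= zdeg F}.

(* [None] is minus infinity. *)
Definition Zpos (A : finType) := option (zfun_pos A).

HB.instance Definition _ A := Choice.on (Zpos A).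

Section ZposSemiring.
Variable A : finType.
Implicit Types F G H : Zpos A.

Definition zval F (a : A) : \bar int := if F is Some G then (val G a)%:E else -oo%E.

Definition Zfinite (F : {ffun A -> int}) (F_ge0 : 0 <= zdeg F) : Zpos A :=
  Some (Sub F F_ge0 : zfun_pos A).

(* Junk value minus infinity when the degree is negative. *)
Definition to_Zpos (F : {ffun A -> int}) : Zpos A :=
  insub F : option (zfun_pos A).

Lemma to_ZposE (F : {ffun A -> int}) (F_ge0 : 0 <= zdeg F) :
  to_Zpos F = Zfinite F_ge0.
Proof. by rewrite /to_Zpos insubT. Qed.

Definition ffun_max (F G : {ffun A -> int}) := [ffun a => Num.max (F a) (G a)].
Definition ffun_plus (F G : {ffun A -> int}) := [ffun a => F a + G a].

Lemma zdeg_max (F G : zfun_pos A) : 0 <= zdeg (ffun_max (val F) (val G)).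
Proof.
apply: le_trans (valP F) _; apply: ler_sum => a _.
by rewrite ffunE le_max lexx.
Qed.
Lemma zdeg_plus (F G : zfun_pos A) : 0 <= zdeg (ffun_plus (val F) (val G)).
Proof.
rewrite /zdeg; under eq_bigr do rewrite ffunE.
by rewrite big_split addr_ge0 //; [exact: (valP F) | exact: (valP G)].
Qed.
Lemma zdeg_const0 : 0 <= zdeg [ffun _ : A => 0].
Proof. by rewrite /zdeg big1 // => a _; rewrite ffunE. Qed.

Definition Zadd F G : Zpos A :=
  match F, G with
  | Some F', Some G' => Zfinite (zdeg_max F' G')
  | None, _ => G
  | _, None => F
  end.
Definition Zmul F G : Zpos A :=
  match F, G with
  | Some F', Some G' => Zfinite (zdeg_plus F' G')
  | _, _ => None
  end.
Definition Zone : Zpos A := Zfinite zdeg_const0.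

Lemma ZaddA : associative Zadd.
Proof.
case=> [F|] [G|] [H|] //=; congr Some; apply: val_inj; apply/ffunP => a /=.
by rewrite !ffunE maxA.
Qed.
Lemma ZaddC : commutative Zadd.
Proof.
case=> [F|] [G|] //=; congr Some; apply: val_inj; apply/ffunP => a /=.
by rewrite !ffunE maxC.
Qed.
Lemma Zadd0 : left_id None Zadd.
Proof. by case. Qed.

HB.instance Definition _ := GRing.isNmodule.Build (Zpos A) ZaddA ZaddC Zadd0.

Lemma ZmulA : associative Zmul.
Proof.
case=> [F|] [G|] [H|] //=; congr Some; apply: val_inj; apply/ffunP => a /=.
by rewrite !ffunE addrA.
Qed.
Lemma ZmulC : commutative Zmul.
Proof.
case=> [F|] [G|] //=; congr Some; apply: val_inj; apply/ffunP => a /=.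
by rewrite !ffunE addrC.
Qed.
Lemma Zmul1 : left_id Zone Zmul.
Proof.
case=> [F|] //=; congr Some; apply: val_inj; apply/ffunP => a /=.
by rewrite !ffunE add0r.
Qed.
Lemma ZmulDl : left_distributive Zmul Zadd.
Proof.
case=> [F|] [G|] [H|] //=; congr Some; apply: val_inj; apply/ffunP => a /=.
by rewrite !ffunE addr_maxl.
Qed.
Lemma Zmul0 : left_zero None Zmul.
Proof. by []. Qed.
Lemma Zone_neq0 : Zone != None.
Proof. by []. Qed.

HB.instance Definition _ := GRing.Nmodule_isComNzSemiRing.Build (Zpos A)
  ZmulA ZmulC Zmul1 ZmulDl Zmul0 Zone_neq0.

Lemma zvalD F G a : zval (F + G) a = maxe (zval F a) (zval G a).
Proof.
by case: F G => [F|] [G|] //=; rewrite ?maxNye // ffunE EFin_max.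
Qed.
Lemma zvalM F G a : zval (F * G) a = (zval F a + zval G a)%E.
Proof. by case: F G => [F|] [G|] //=; rewrite ffunE EFinD. Qed.

(* On an empty set the constant map minus infinity has no value: hence the    *)
(* element of [A].                                                            *)
Lemma zval_inj (a0 : A) F G : zval F =1 zval G -> F = G.
Proof.
case: F G => [F|] [G|] //= h; try by have := h a0.
by congr Some; apply: val_inj; apply/ffunP => a; have [] := h a.
Qed.

End ZposSemiring.

Section Image.
Variables (S T : comNzSemiRingType) (phi : {rmorphism S -> T}).

Definition in_image : {pred T} := fun y => `[< exists f, phi f = y >].

Lemma in_image_semiring : semiring_closed in_image.
Proof.
split; split.
- by apply/asboolP; exists 0; rewrite rmorph0.
- move=> _ _ /asboolP [f <-] /asboolP [g <-].
  by apply/asboolP; exists (f + g); rewrite rmorphD.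
- by apply/asboolP; exists 1; rewrite rmorph1.
- move=> _ _ /asboolP [f <-] /asboolP [g <-].
  by apply/asboolP; exists (f * g); rewrite rmorphM.
Qed.

HB.instance Definition _ :=
  GRing.isSemiringClosed.Build T in_image in_image_semiring.

Record hom_image := HomImage { image_val :> T; image_valP : image_val \in in_image }.

HB.instance Definition _ := [isSub for image_val].
HB.instance Definition _ := [Choice of hom_image by <:].
HB.instance Definition _ := [SubChoice_isSubComNzSemiRing of hom_image by <:].

Lemma in_imageP f : phi f \in in_image.
Proof. by apply/asboolP; exists f. Qed.

Definition to_image (f : S) : hom_image := HomImage (in_imageP f).

Lemma to_image_surj (y : hom_image) : exists f, y = to_image f.
Proof.
by have /asboolP [f fy] := image_valP y; exists f; apply: val_inj.
Qed.

Lemma to_image_nmod : nmod_morphism to_image.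
Proof. by split=> [|f g]; apply: val_inj; rewrite /= ?rmorph0 ?rmorphD. Qed.
Lemma to_image_monoid : monoid_morphism to_image.
Proof. by split=> [|f g]; apply: val_inj; rewrite /= ?rmorph1 ?rmorphM. Qed.

HB.instance Definition _ :=
  GRing.isNmodMorphism.Build S hom_image to_image to_image_nmod.
HB.instance Definition _ :=
  GRing.isMonoidMorphism.Build S hom_image to_image to_image_monoid.

End Image.

Section Fans.
Variables (R : realType) (n : nat).
Implicit Types (d : 'rV[int]_n) (f : fcn R n).

Definition ray d : set 'rV[R]_n :=
  [set q | exists2 t : R, 0 <= t & q = t *: intmx R d]%classic.

Definition rational_ray (rho : set 'rV[R]_n) : Prop := exists2 d, d != 0 & rho = ray d.

Definition primitive d : bool := (\big[gcdn/0%N]_i absz (d 0 i)) == 1%N.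

Definition prim (rho : set 'rV[R]_n) : 'rV[int]_n :=
  xget 0 [set d | primitive d /\ rho = ray d]%classic.

Lemma primitive_neq0 d : primitive d -> d != 0.
Proof.
apply: contraTneq => ->; rewrite /primitive big1 // => i _.
by rewrite mxE.
Qed.

Lemma gcd_scale (c : int) d :
  \big[gcdn/0%N]_i absz ((c *: d) 0 i) = (absz c * \big[gcdn/0%N]_i absz (d 0%R i))%N.
Proof.
rewrite (big_morph (muln (absz c)) (@muln_gcdr (absz c)) (muln0 _)).
by apply: eq_bigr => i _; rewrite mxE abszM.
Qed.

Lemma ray_self d : ray d (intmx R d).
Proof. by exists 1; rewrite ?scale1r. Qed.

Lemma primitive_inj d d' : primitive d -> primitive d' -> ray d = ray d' -> d = d'.
Proof.
move=> pd pd' e; have := ray_self d; rewrite e => -[t t0 dE].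
have /rV0Pn [i di] := primitive_neq0 pd'.
have dEj j : (d 0 j)%:~R = t * (d' 0 j)%:~R :> R.
  by move/rowP/(_ j): dE; rewrite !mxE.
have cross : d' 0 i *: d = d 0 i *: d'.
  apply/rowP => j; apply: (@intr_inj R).
  by rewrite !mxE !rmorphM /= !dEj mulrCA mulrA.
have absE : absz (d' 0 i) = absz (d 0 i).
  have := gcd_scale (d' 0 i) d; rewrite cross gcd_scale.
  by rewrite (eqP pd) (eqP pd') !muln1.
have dirn0 : (d' 0 i)%:~R != 0 :> R by rewrite intr_eq0.
have t1 : t = 1.
  have : `|(d 0 i)%:~R| = `|(d' 0 i)%:~R| :> R.
    by rewrite -!intr_norm -!abszE absE.
  rewrite dEj normrM (ger0_norm t0) -[RHS]mul1r => /mulIf; apply.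
  by rewrite normr_eq0.
apply/rowP => j; apply: (@intr_inj R).
by rewrite dEj t1 mul1r.
Qed.

Lemma rational_ray_primitive rho :
  rational_ray rho -> exists2 d, primitive d & rho = ray d.
Proof.
move=> [d dn0 ->]; pose g := \big[gcdn/0%N]_i absz (d 0 i).
have g_dvd i : (g %| absz (d 0%R i))%N by rewrite /g (bigD1 i) //= dvdn_gcdl.
have g_gt0 : (0 < g)%N.
  have /rV0Pn [i di] := dn0; rewrite lt0n; apply: contraNneq di => g0.
  by have := g_dvd i; rewrite g0 dvd0n absz_eq0.
pose d' : 'rV[int]_n := \row_i ((d 0%R i) %/ g%:Z)%Z.
have dE : d = g%:Z *: d'.
  apply/rowP => i; rewrite !mxE mulrC divzK //.
  by rewrite dvdzE absz_nat.
exists d'.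
  have := gcd_scale g%:Z d'; rewrite -dE absz_nat -/g => /eqP.
  rewrite -{1}[g]muln1 eqn_pmul2l // => /eqP h.
  by rewrite /primitive -h.
have gR : (0 : R) < g%:R by rewrite ltr0n.
have intE : intmx R d = g%:R *: intmx R d'.
  by rewrite dE; apply/rowP => i; rewrite !mxE rmorphM.
apply/seteqP; split=> q [t t0 ->].
  exists (t * g%:R); first by rewrite mulr_ge0 ?ler0n.
  by rewrite intE scalerA.
exists (t / g%:R); first by rewrite divr_ge0 ?ler0n.
by rewrite intE scalerA divfK // gt_eqF.
Qed.

Lemma primP rho : rational_ray rho -> primitive (prim rho) /\ rho = ray (prim rho).
Proof.
move=> /rational_ray_primitive [d pd rhoE].
by apply: (@xgetPex _ 0 [set d | primitive d /\ rho = ray d]%classic); exists d.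
Qed.

Lemma prim_ray d : primitive d -> prim (ray d) = d.
Proof.
move=> pd; have /primP [h1 h2] : rational_ray (ray d).
  by exists d => //; apply: primitive_neq0.
exact: primitive_inj (esym h2).
Qed.

(* A fan is given by its set [fan_rays] of one-dimensional cones: the cone    *)
(* {0} carries no data.                                                       *)
Record fan := Fan {
  fan_rays : {fset (set 'rV[R]_n)};
  fan_rational : forall rho, rho \in fan_rays -> rational_ray rho;
  fan_nonempty : fan_rays != fset0;
  weight : fan_rays -> int;
  weight_gt0 : forall rho, 0 < weight rho;
  fan_balanced : \sum_(rho : fan_rays) weight rho *: prim (val rho) = 0
}.

(* A fan has a ray, so n >= 1 is automatic, also for realizable homomorphisms. *)
Lemma fan_pos_dim : fan -> (0 < n)%N.
Proof.
case=> rays rat /fset0Pn [rho /rat [d /rV0Pn [i _] _]] _ _ _.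
exact: leq_ltn_trans (ltn_ord i).
Qed.

Definition fan_support (X : fan) : set 'rV[R]_n :=
  [set q | exists2 rho, rho \in fan_rays X & rho q]%classic.

Definition idot (u d : 'rV[int]_n) : int := \sum_i u 0 i * d 0 i.

Lemma dot_int u d : dot u (intmx R d) = (idot u d)%:~R.
Proof.
rewrite /dot /idot rmorph_sum; apply: eq_bigr => i _.
by rewrite mxE rmorphM.
Qed.

(* A nonzero function has integer values at integer vectors, see [fevalE].    *)
Definition zfeval f d : int := Num.floor (fine (feval f (intmx R d))).

Lemma fevalE f d : f != 0 -> feval f (intmx R d) = (zfeval f d)%:~R%:E.
Proof.
move=> f0; rewrite /zfeval /feval.
have [r0|[u _ ->]] := leval_attained (repr f) (intmx R d).
  by case/eqP: f0; rewrite -(fclassK f) r0.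
by rewrite dot_int /= intrKfloor.
Qed.

Lemma zfevalE f d (z : int) : feval f (intmx R d) = z%:~R%:E -> zfeval f d = z.
Proof. by rewrite /zfeval => -> /=; rewrite intrKfloor. Qed.

Lemma fcn_eq0 f : (exists q, feval f q = -oo%E) -> f = 0.
Proof.
move=> [q]; rewrite /feval.
have [r0 _|[u _ ->] //] := leval_attained (repr f) q.
by rewrite -(fclassK f) r0.
Qed.

Lemma fadd_neq0 f g : f != 0 -> f + g != 0.
Proof.
move=> f0; apply: contraNneq f0 => /(congr1 (fun h => feval h 0)).
rewrite fevalD feval0 => e; apply/eqP/fcn_eq0; exists 0; apply/eqP.
by rewrite -leeNy_eq -e le_max lexx.
Qed.

Lemma fmul_neq0 f g : f != 0 -> g != 0 -> f * g != 0.
Proof.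
move=> f0 g0; apply/eqP => /(congr1 (fun h => feval h (intmx R 0))).
by rewrite fevalM feval0 (fevalE _ f0) (fevalE _ g0).
Qed.

Variable X : fan.

Definition phi_values f : {ffun fan_rays X -> int} :=
  [ffun rho => weight rho * zfeval f (prim (val rho))].

Lemma phi_values_deg f : f != 0 -> 0 <= zdeg (phi_values f).
Proof.
move=> f0.
have [r0|[u ru _]] := leval_attained (repr f) (0 : 'rV[R]_n).
  by case/eqP: f0; rewrite -(fclassK f) r0.
have -> : 0 = \sum_rho weight rho * idot u (prim (val (rho : fan_rays X))).
  pose s := \sum_(rho : fan_rays X) weight rho *: prim (val rho).
  have -> : \sum_(rho : fan_rays X) weight rho * idot u (prim (val rho)) = idot u s.
    rewrite /idot; under eq_bigr => rho _ do rewrite mulr_sumr.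
    rewrite exchange_big; apply: eq_bigr => i _.
    rewrite /s summxE mulr_sumr; apply: eq_bigr => rho _.
    by rewrite mxE mulrCA.
  by rewrite /s fan_balanced /idot big1 // => i _; rewrite mxE mulr0.
apply: ler_sum => rho _; rewrite ffunE ler_pM2l ?weight_gt0 //.
rewrite -(ler_int R) -lee_fin -(fevalE _ f0) -dot_int.
exact: leval_ge.
Qed.

(* [to_Zpos] does not return its junk value here, by [phi_values_deg]; see    *)
(* [phi_valueE] for the defining formula.                                     *)
Definition phi f : Zpos (fan_rays X) :=
  if f == 0 then 0 else to_Zpos (phi_values f).

Lemma phi0 : phi 0 = 0.
Proof. by rewrite /phi eqxx. Qed.

Lemma phi_neq0E f (f0 : f != 0) : phi f = Zfinite (phi_values_deg f0).
Proof. by rewrite /phi (negbTE f0) (to_ZposE (phi_values_deg f0)). Qed.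

Lemma phi_valueE f (rho : fan_rays X) :
  er_map (intr : int -> R) (zval (phi f) rho) =
  ((weight rho)%:~R%:E * feval f (intmx R (prim (val rho))))%E.
Proof.
have [->|f0] := eqVneq f 0.
  by rewrite phi0 feval0 /= mulrNy gtr0_sg ?ltr0z ?weight_gt0 // mul1e.
by rewrite (phi_neq0E f0) /= ffunE rmorphM (fevalE _ f0).
Qed.

Lemma phi_nmod : nmod_morphism phi.
Proof.
split=> [|f g]; first exact: phi0.
have [->|f0] := eqVneq f 0; first by rewrite phi0 !add0r.
have [->|g0] := eqVneq g 0; first by rewrite phi0 !addr0.
rewrite (phi_neq0E (fadd_neq0 g f0)) (phi_neq0E f0) (phi_neq0E g0).
congr Some; apply: val_inj; apply/ffunP => rho; rewrite /= !ffunE.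
rewrite -maxr_pMr ?ltW ?weight_gt0 //; congr (_ * _).
apply: zfevalE; rewrite fevalD (fevalE _ f0) (fevalE _ g0) -EFin_max; congr EFin.
by rewrite /Order.max !ltr_int; case: ifP.
Qed.

Lemma phi_monoid : monoid_morphism phi.
Proof.
split=> [|f g].
  have f0 : (1 : fcn R n) != 0 by exact: oner_neq0.
  rewrite (phi_neq0E f0); congr Some; apply: val_inj; apply/ffunP => rho.
  by rewrite /= !ffunE (@zfevalE _ _ 0) ?mulr0 // feval1.
have [->|f0] := eqVneq f 0; first by rewrite mul0r phi0 mul0r.
have [->|g0] := eqVneq g 0; first by rewrite mulr0 phi0 mulr0.
rewrite (phi_neq0E (fmul_neq0 f0 g0)) (phi_neq0E f0) (phi_neq0E g0).
congr Some; apply: val_inj; apply/ffunP => rho; rewrite /= !ffunE.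
rewrite -mulrDr; congr (_ * _).
by apply: zfevalE; rewrite fevalM (fevalE _ f0) (fevalE _ g0) rmorphD.
Qed.

HB.instance Definition _ := GRing.isNmodMorphism.Build (fcn R n)
  (Zpos (fan_rays X)) phi phi_nmod.
HB.instance Definition _ := GRing.isMonoidMorphism.Build (fcn R n)
  (Zpos (fan_rays X)) phi phi_monoid.

End Fans.

Section Monomials.
Variables (R : realType) (n : nat).

Lemma lmonomialD (u v : 'rV[int]_n) :
  lmonomial (u + v) = lmonomial u * lmonomial v.
Proof.
apply: laurentP => w; apply: B_eqP; split.
  rewrite lmonomialE; case: eqP => // -> _; apply/lmul1P; exists u.
    by rewrite lmonomialE eqxx.
  by rewrite lmonomialE [u + v]addrC addrK eqxx.
move=> /lmul1P [x]; rewrite !lmonomialE; case: eqP => // -> _.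
by case: eqP => // <- _; rewrite addrC subrK eqxx.
Qed.

Definition fmono (u : 'rV[int]_n) : fcn R n := fclass R (lmonomial u).

Lemma fmonoD u v : fmono (u + v) = fmono u * fmono v.
Proof. by rewrite /fmono lmonomialD rmorphM. Qed.

Lemma fmono0 : fmono 0 = 1. Proof. by []. Qed.

Lemma fmonoV u : fmono u * fmono (- u) = 1.
Proof. by rewrite -fmonoD subrr. Qed.

Lemma fcn_sum_mono (f : fcn R n) : f = \sum_(u <- lsupp (repr f)) fmono u.
Proof.
apply: fevalP => q.
have -> : \sum_(u <- lsupp (repr f)) fmono u = fsubst 1%:M f.
  rewrite /fsubst /lsubst rmorph_sum; apply: eq_bigr => u _.
  by rewrite trmx1 mulmx1.
by rewrite feval_subst map_mx1 mulmx1.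
Qed.

Definition fvar (i : 'I_n) : fcn R n := fclass R (lvar i).

End Monomials.

Section Realizable.
Variable R : realType.

Definition realizable n (A : finType) (phi0 : {rmorphism fcn R n -> Zpos A}) :=
  exists (X : fan R n) (sigma : A -> fan_rays X),
    bijective sigma /\
    forall f a, zval (phi0 f) a = zval (phi X f) (sigma a).

Definition geometric n m (A B : finType)
    (phi1 : {rmorphism fcn R n -> Zpos A}) (phi2 : {rmorphism fcn R m -> Zpos B})
    (nu : {rmorphism hom_image phi1 -> hom_image phi2}) :=
  forall b : B, exists (a : A) (t : rat), 0 <= t /\
    forall i : 'I_n,
      er_map intr (zval (val (nu (to_image phi1 (fvar R i)))) b) =
      (t%:E * er_map intr (zval (phi1 (fvar R i)) a))%E.

End Realizable.

Section GeometricComposition.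
Variables (R : realType).

Lemma er_map_max (x y : \bar int) :
  er_map (intr : int -> rat) (maxe x y) = maxe (er_map intr x) (er_map intr y).
Proof.
have mono (a b : \bar int) : (a <= b)%E -> (er_map (intr : int -> rat) a <= er_map intr b)%E.
  by case: a b => [a| |] [b| |]; rewrite /= ?lee_fin ?ler_int ?leNye ?leey.
have [xy|/ltW yx] := leP x y.
  by apply/esym/max_idPr/mono.
by apply/esym/max_idPl/mono.
Qed.

Lemma zval_sum (A : finType) (I : Type) (r : seq I) (F : I -> Zpos A) a :
  zval (\sum_(i <- r) F i) a = \big[maxe/-oo%E]_(i <- r) zval (F i) a.
Proof.
by apply: (big_morph (fun G => zval G a)) => // F1 F2; apply: zvalD.
Qed.

Lemma mul_bigmaxe (I : Type) (r : seq I) (i0 : I) (F G : I -> \bar int) (t : rat) :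
  0 <= t ->
  (forall i, er_map (intr : int -> rat) (F i) = (t%:E * er_map intr (G i))%E) ->
  er_map (intr : int -> rat) (\big[maxe/-oo%E]_(i <- i0 :: r) F i) =
  (t%:E * er_map (intr : int -> rat) (\big[maxe/-oo%E]_(i <- i0 :: r) G i))%E.
Proof.
move=> t0 FG; elim: r i0 => [|i r IH] i0.
  by rewrite !big_cons !big_nil !maxeNy.
rewrite big_cons [in RHS]big_cons !er_map_max IH FG maxe_pMr //.
Qed.

Section Values.
Variables (n : nat) (A B : finType).
Variables (al : {rmorphism fcn R n -> Zpos A}) (be : {rmorphism fcn R n -> Zpos B}).
Variables (a : A) (b : B) (t : rat).
Hypothesis t_ge0 : 0 <= t.
Hypothesis t_var : forall i, er_map (intr : int -> rat) (zval (al (fvar R i)) a) =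
  (t%:E * er_map intr (zval (be (fvar R i)) b))%E.

Definition mono_val C (ga : fcn R n -> Zpos C) (c : C) u : int :=
  if zval (ga (fmono R u)) c is z%:E%E then z else 0.

Lemma mono_valE C (ga : {rmorphism fcn R n -> Zpos C}) c u :
  zval (ga (fmono R u)) c = (mono_val ga c u)%:E%E.
Proof.
rewrite /mono_val; case e : (ga (fmono R u)) => [F|] //.
have := rmorph1 ga; rewrite -(fmonoV R u) rmorphM e => h.
by have := mul0r (ga (fmono R (- u))); rewrite [LHS]h.
Qed.

Lemma mono_valD C (ga : {rmorphism fcn R n -> Zpos C}) c u v :
  mono_val ga c (u + v) = mono_val ga c u + mono_val ga c v.
Proof.
apply: EFin_inj; rewrite -mono_valE fmonoD rmorphM zvalM !mono_valE.
by rewrite EFinD.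
Qed.

Let h (u : 'rV[int]_n) : rat := (mono_val al a u)%:~R - t * (mono_val be b u)%:~R.

Lemma h_zmod : zmod_morphism h.
Proof.
have hD u v : h (u + v) = h u + h v.
  by rewrite /h !mono_valD !rmorphD mulrDr opprD addrACA.
by move=> u v; apply: (addIr (h v)); rewrite -hD !subrK.
Qed.

Lemma t_mono u : er_map (intr : int -> rat) (zval (al (fmono R u)) a) =
  (t%:E * er_map intr (zval (be (fmono R u)) b))%E.
Proof.
rewrite !mono_valE /= -EFinM; congr EFin; apply/eqP; rewrite -subr_eq0.
pose hm := GRing.isZmodMorphism.Build _ _ h h_zmod.
pose H : {additive 'rV[int]_n -> rat} := HB.pack h hm.
change (H u == 0); rewrite [u]row_sum_delta raddf_sum big1 // => i _.
rewrite -[u 0 i]intz scaler_int raddfMz /= /h; have := t_var i.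
rewrite -[fvar R i]/(fmono R (delta_mx 0 i)) !mono_valE /= -EFinM => -[->].
by rewrite subrr mul0rz.
Qed.

Lemma t_fcn f : f != 0 -> er_map (intr : int -> rat) (zval (al f) a) =
  (t%:E * er_map intr (zval (be f) b))%E.
Proof.
rewrite [f]fcn_sum_mono; case: (enum_fset _) => [|u s] f0.
  by rewrite big_nil eqxx in f0.
rewrite !rmorph_sum !zval_sum; apply: mul_bigmaxe => // v.
exact: t_mono.
Qed.

End Values.

Lemma rmorph_ext (S T : pzSemiRingType) (f g : {rmorphism S -> T}) : f =1 g -> f = g.
Proof.
move=> /funext; case: f g => [f [[f1] [f2]]] [g [[g1] [g2]]] /= fg.
by subst g; rewrite (Prop_irrelevance f1 g1) (Prop_irrelevance f2 g2).
Qed.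

Lemma geometric_id n (A : finType) (phi0 : {rmorphism fcn R n -> Zpos A}) :
  geometric (idfun : {rmorphism hom_image phi0 -> hom_image phi0}).
Proof. by move=> a; exists a, 1; split=> // i; rewrite mul1e. Qed.

Lemma geometric_comp n1 n2 n3 (A1 A2 A3 : finType)
    (phi1 : {rmorphism fcn R n1 -> Zpos A1})
    (phi2 : {rmorphism fcn R n2 -> Zpos A2})
    (phi3 : {rmorphism fcn R n3 -> Zpos A3})
    (nu' : {rmorphism hom_image phi2 -> hom_image phi3})
    (nu : {rmorphism hom_image phi1 -> hom_image phi2}) :
  geometric nu' -> geometric nu ->
  geometric (nu' \o nu : {rmorphism hom_image phi1 -> hom_image phi3}).
Proof.
move=> g' g c; have [b [t [t0 tE]]] := g' c; have [a [s [s0 sE]]] := g b.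
exists a, (t * s); split=> [|i]; first exact: mulr_ge0.
have [f fE] := to_image_surj (nu (to_image phi1 (fvar R i))).
have f0 : f != 0.
  apply/eqP => f0; move: fE; rewrite f0 rmorph0 => nu0.
  have := rmorph1 nu; rewrite -(rmorph1 (to_image phi1)) -(fmonoV R (delta_mx 0 i)).
  by rewrite !rmorphM [X in X * _]nu0 mul0r => /esym/eqP; rewrite oner_eq0.
rewrite EFinM -muleA -sE fE /= fE.
pose al : {rmorphism fcn R n2 -> Zpos A3} := val \o nu' \o to_image phi2.
exact: (@t_fcn n2 A3 A2 al phi2 c b t t0 tE f f0).
Qed.

End GeometricComposition.

Record category := Category {
  obj :> Type;
  mor : obj -> obj -> Type;
  mor_id : forall X, mor X X;
  mor_comp : forall X Y Z, mor Y Z -> mor X Y -> mor X Z;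
  mor_comp_idl : forall X Y (f : mor X Y), mor_comp (mor_id Y) f = f;
  mor_comp_idr : forall X Y (f : mor X Y), mor_comp f (mor_id X) = f;
  mor_compA : forall X Y Z W (f : mor X Y) (g : mor Y Z) (h : mor Z W),
    mor_comp h (mor_comp g f) = mor_comp (mor_comp h g) f
}.

Definition contravariant_functor (C D : category) (F : C -> D)
    (Fmap : forall X Y : C, mor X Y -> mor (F Y) (F X)) : Prop :=
  (forall X, Fmap X X (mor_id X) = mor_id (F X)) /\
  (forall X Y Z (f : mor X Y) (g : mor Y Z),
    Fmap X Z (mor_comp g f) = mor_comp (Fmap X Y f) (Fmap Y Z g)).

Definition fully_faithful (C D : category) (F : C -> D)
    (Fmap : forall X Y : C, mor X Y -> mor (F Y) (F X)) : Prop :=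
  forall X Y, bijective (Fmap X Y).

Section Categories.
Variable R : realType.

Record fan_obj := FanObj {
  fan_dim : nat;
  fan_dim_gt0 : (0 < fan_dim)%N;
  fan_of :> fan R fan_dim
}.

Definition restricts n m (X : fan R n) (Y : fan R m)
    (mu : fan_support X -> fan_support Y) (M : 'M[int]_(n, m)) : Prop :=
  forall x : fan_support X, val (mu x) = val x *m intmx R M.

Record fan_mor (X Y : fan_obj) := FanMor {
  fan_map :> fan_support X -> fan_support Y;
  fan_mapP : exists M : 'M[int]_(fan_dim X, fan_dim Y), restricts fan_map M
}.

Lemma fan_mor_ext X Y (f g : fan_mor X Y) : f =1 g -> f = g.
Proof.
case: f g => [f fP] [g gP] /funext /= fg; subst g.
by rewrite (Prop_irrelevance fP gP).
Qed.

Lemma fan_idP (X : fan_obj) :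
  exists M : 'M[int]_(fan_dim X, fan_dim X), restricts (@idfun (fan_support X)) M.
Proof. by exists 1%:M => x; rewrite map_mx1 mulmx1. Qed.

Lemma fan_compP (X Y Z : fan_obj) (g : fan_mor Y Z) (f : fan_mor X Y) :
  exists M : 'M[int]_(fan_dim X, fan_dim Z), restricts (g \o f) M.
Proof.
have [N gN] := fan_mapP g; have [M fM] := fan_mapP f.
by exists (M *m N) => x; rewrite gN fM map_mxM mulmxA.
Qed.

Definition fan_id X : fan_mor X X := FanMor (fan_idP X).
Definition fan_comp X Y Z (g : fan_mor Y Z) (f : fan_mor X Y) : fan_mor X Z :=
  FanMor (fan_compP g f).

Lemma fan_comp_idl X Y (f : fan_mor X Y) : fan_comp (fan_id Y) f = f.
Proof. exact: fan_mor_ext. Qed.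
Lemma fan_comp_idr X Y (f : fan_mor X Y) : fan_comp f (fan_id X) = f.
Proof. exact: fan_mor_ext. Qed.
Lemma fan_compA X Y Z W (f : fan_mor X Y) (g : fan_mor Y Z) (h : fan_mor Z W) :
  fan_comp h (fan_comp g f) = fan_comp (fan_comp h g) f.
Proof. exact: fan_mor_ext. Qed.

Definition fan_category : category :=
  Category fan_comp_idl fan_comp_idr fan_compA.

Record realizable_hom := RealizableHom {
  rh_dim : nat;
  rh_set : finType;
  rh_map :> {rmorphism fcn R rh_dim -> Zpos rh_set};
  rh_realizable : realizable rh_map
}.

Record geometric_mor (f g : realizable_hom) := GeometricMor {
  geometric_map :> {rmorphism hom_image f -> hom_image g};
  geometric_mapP : geometric geometric_map
}.

Lemma geometric_mor_ext f g (nu nu' : geometric_mor f g) : nu =1 nu' -> nu = nu'.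
Proof.
case: nu nu' => [nu nuP] [nu' nuP'] /rmorph_ext /= e; subst nu'.
by rewrite (Prop_irrelevance nuP nuP').
Qed.

Definition geometric_mor_id f : geometric_mor f f := GeometricMor (geometric_id f).
Definition geometric_mor_comp f g h (nu' : geometric_mor g h)
    (nu : geometric_mor f g) : geometric_mor f h :=
  GeometricMor (geometric_comp (geometric_mapP nu') (geometric_mapP nu)).

Lemma geometric_comp_idl f g (nu : geometric_mor f g) :
  geometric_mor_comp (geometric_mor_id g) nu = nu.
Proof. exact: geometric_mor_ext. Qed.
Lemma geometric_comp_idr f g (nu : geometric_mor f g) :
  geometric_mor_comp nu (geometric_mor_id f) = nu.
Proof. exact: geometric_mor_ext. Qed.
Lemma geometric_compA f g h k (nu : geometric_mor f g) (nu' : geometric_mor g h)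
    (nu'' : geometric_mor h k) :
  geometric_mor_comp nu'' (geometric_mor_comp nu' nu) =
  geometric_mor_comp (geometric_mor_comp nu'' nu') nu.
Proof. exact: geometric_mor_ext. Qed.

Definition realizable_category : category :=
  Category geometric_comp_idl geometric_comp_idr geometric_compA.

Lemma phi_realizable n (X : fan R n) : realizable (phi X).
Proof. by exists X, id; split=> //; exists id. Qed.

Definition phi_obj (X : fan_obj) : realizable_hom :=
  RealizableHom (phi_realizable X).

(* [nu] is the morphism mu^*, whichever linear extension of [mu] is used.     *)
Definition is_mu_star (X Y : fan_obj) (mu : fan_mor X Y)
    (nu : geometric_mor (phi_obj Y) (phi_obj X)) : Prop :=
  forall M : 'M[int]_(fan_dim X, fan_dim Y), restricts mu M ->
  forall f : fcn R (fan_dim Y),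
    nu (to_image (phi Y) f) = to_image (phi X) (fsubst M f).

End Categories.

(* Main.v *)
From HB Require Import structures.
From mathcomp Require Import all_boot all_order all_algebra finmap.
From mathcomp Require Import boolp classical_sets constructive_ereal.
Require Import Defs.
From mathcomp Require Import reals.

Set Implicit Arguments.
Unset Strict Implicit.
Unset Printing Implicit Defensive.

Import Order.TTheory GRing.Theory Num.Theory.
Local Open Scope ring_scope.

(** Since tropical Laurent polynomials are positively homogeneous, [phi_X f]
    determines and is determined by [f] on the support of [X]; so a linear map
    [|X| -> |Y|] pulls [Im phi_Y] back to [Im phi_X]. Conversely a homomorphism
    [nu] sends each variable to a unit of [Im phi_X], and by balancing every
    unit of [Im phi_X] is the class of a Laurent monomial: if [phi_X g] and
    [phi_X g'] are inverse to each other, then any [u] in the support of [g]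
    and [u'] in the support of [g'] satisfy [(u + u') . d <= 0] on all rays,
    while these numbers have weighted sum zero. The exponents of these
    monomials form an integer matrix inducing [nu], and being geometric says
    exactly that this matrix maps each ray of [X] into some ray of [Y]. *)

(** * Homomorphisms out of an image, and substitution *)

Lemma image_factor (S T U : comNzSemiRingType) (phi : {rmorphism S -> T})
    (h : {rmorphism S -> U}) :
  (forall f g, phi f = phi g -> h f = h g) ->
  exists nu : {rmorphism hom_image phi -> U}, forall f, nu (to_image phi f) = h f.
Proof.
(* [h] is evaluated at an arbitrary preimage; [hP] makes the choice irrelevant, so [k] inherits the
   morphism laws from [h]. *)
move=> hP; pose k (y : hom_image phi) : U := h (projT1 (cid (to_image_surj y))).
have kE f : k (to_image phi f) = h f.
  rewrite /k; case: cid => g /= e; apply: hP.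
  by have := congr1 val e.
have knmod : nmod_morphism k.
  split=> [|x y]; first by rewrite -(rmorph0 (to_image phi)) kE rmorph0.
  have [f ->] := to_image_surj x; have [g ->] := to_image_surj y.
  by rewrite -rmorphD !kE rmorphD.
have kmon : monoid_morphism k.
  split=> [|x y]; first by rewrite -(rmorph1 (to_image phi)) kE rmorph1.
  have [f ->] := to_image_surj x; have [g ->] := to_image_surj y.
  by rewrite -rmorphM !kE rmorphM.
pose kn := GRing.isNmodMorphism.Build _ _ k knmod.
pose km := GRing.isMonoidMorphism.Build _ _ k kmon.
pose K : {rmorphism hom_image phi -> U} := HB.pack k kn km.
by exists K.
Qed.

Section Substitution.
Variables (R : realType) (n m : nat) (M : 'M[int]_(n, m)).

Lemma fsubst_nmod : nmod_morphism (@fsubst R n m M).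
Proof.
by split=> [|f g]; apply: fevalP => q; rewrite ?fevalD !feval_subst ?fevalD ?feval0.
Qed.

Lemma fsubst_monoid : monoid_morphism (@fsubst R n m M).
Proof.
by split=> [|f g]; apply: fevalP => q; rewrite ?fevalM !feval_subst ?fevalM ?feval1.
Qed.

HB.instance Definition _ :=
  GRing.isNmodMorphism.Build (fcn R m) (fcn R n) (@fsubst R n m M) fsubst_nmod.
HB.instance Definition _ :=
  GRing.isMonoidMorphism.Build (fcn R m) (fcn R n) (@fsubst R n m M) fsubst_monoid.

Lemma fsubst_mono u : fsubst M (fmono R u) = fmono R (u *m M^T).
Proof.
by apply: fevalP => q; rewrite feval_subst !feval_class !leval_monomial dot_mulmx.
Qed.

End Substitution.

(** * Homogeneity of functions, and generation by variables *)

Section Evaluation.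
Variables (R : realType) (n : nat).
Implicit Types (f g : fcn R n) (q : 'rV[R]_n).

Lemma dotZ u (t : R) q : dot u (t *: q) = t * dot u q.
Proof. by rewrite /dot mulr_sumr; apply: eq_bigr => i _; rewrite mxE mulrCA. Qed.

Lemma feval_attained f q : f != 0 ->
  exists2 u, repr f u = 1 & feval f q = (dot u q)%:E.
Proof.
move=> f0; have [r0|//] := leval_attained (repr f) q.
by case/eqP: f0; rewrite -(fclassK f) r0.
Qed.

Lemma feval_ge f q u : repr f u = 1 -> ((dot u q)%:E <= feval f q)%E.
Proof. exact: leval_ge. Qed.

(** Scaling by [t >= 0] preserves the order of the competing monomials. The zero function is
    excluded because of [t = 0], where [0 * -oo] is [0]. *)
Lemma fevalZ f (t : R) q : f != 0 -> 0 <= t ->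
  feval f (t *: q) = (t%:E * feval f q)%E.
Proof.
move=> f0 t0; have [u fu uE] := feval_attained q f0.
have [v fv vE] := feval_attained (t *: q) f0.
apply/eqP; rewrite eq_le; apply/andP; split.
  by rewrite vE dotZ EFinM lee_wpmul2l ?lee_fin ?feval_ge.
by rewrite uE -EFinM -dotZ feval_ge.
Qed.

(** The zero function is covered too: a function that is minus infinity at one point is zero, so [f]
    and [g] vanish together. *)
Lemma feval_eqZ f g (t : R) q : 0 <= t ->
  feval f q = feval g q -> feval f (t *: q) = feval g (t *: q).
Proof.
move=> t0 fg.
have [f0|f0] := eqVneq f 0; last have [g0|g0] := eqVneq g 0.
- have -> : g = 0 by apply: fcn_eq0; exists q; rewrite -fg f0 feval0.
  by rewrite f0.
- by case/eqP: f0; apply: fcn_eq0; exists q; rewrite fg g0 feval0.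
- by rewrite !fevalZ ?fg.
Qed.

Lemma feval_mono u q : feval (fmono R u) q = (dot u q)%:E.
Proof. by rewrite feval_class leval_monomial. Qed.

Lemma dot_delta i q : dot (delta_mx 0 i) q = q 0 i.
Proof.
rewrite /dot (bigD1 i) //= big1 => [|j ji].
  by rewrite mxE !eqxx mul1r addr0.
by rewrite mxE (negbTE ji) andbF mul0r.
Qed.

Lemma feval_var i q : feval (fvar R i) q = (q 0 i)%:E.
Proof. by rewrite feval_mono dot_delta. Qed.

Lemma fcn_rmorph_ext (T : comNzSemiRingType) (h k : {rmorphism fcn R n -> T}) :
  (forall i, h (fvar R i) = k (fvar R i)) -> h =1 k.
Proof.
move=> hk; pose ok u := h (fmono R u) = k (fmono R u).
have okD u v : ok u -> ok v -> ok (u + v).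
  by move=> hu hv; rewrite /ok fmonoD !rmorphM hu hv.
(* Inverses are unique: both maps send the monomial of exponent [- u] to the inverse of the same
   element. *)
have okN u : ok u -> ok (- u).
  move=> hu; rewrite /ok -[LHS]mulr1 -(rmorph1 k) -(fmonoV R u) rmorphM -hu.
  by rewrite mulrA -rmorphM [fmono R (- u) * _]mulrC fmonoV rmorph1 mul1r.
have ok0 : ok 0 by rewrite /ok fmono0 !rmorph1.
have okMn u j : ok u -> ok (u *+ j).
  by move=> hu; elim: j => [|j IH]; rewrite ?mulrS; [exact: ok0 | exact: okD].
have okT u : ok u.
  rewrite [u]row_sum_delta; apply: big_ind => // i _.
  rewrite -[u 0 i]intz scaler_int.
  case: (u 0 i) => j; first by apply: okMn; apply: hk.
  by rewrite NegzE mulrNz; apply/okN/okMn/hk.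
move=> f; rewrite [f]fcn_sum_mono !rmorph_sum; apply: eq_bigr => u _.
exact: okT.
Qed.

End Evaluation.

Lemma er_map_intr_inj (K : numDomainType) : injective (er_map (intr : int -> K)).
Proof. by move=> [x| |] [y| |] //= [/intr_inj ->]. Qed.

(** * Equality and units in the image of [phi X] *)

Section FanHomomorphism.
Variables (R : realType) (n : nat) (X : fan R n).

Lemma fan_ray (rho : fan_rays X) : val rho = @ray R n (prim (val rho)).
Proof. by have [] := primP (fan_rational (valP rho)). Qed.

Lemma fan_support_prim (rho : fan_rays X) :
  fan_support X (intmx R (prim (val rho))).
Proof.
by exists (val rho); [exact: valP | rewrite [X in X _]fan_ray; exact: ray_self].
Qed.

Lemma fan_supportP q : fan_support X q ->
  exists (rho : fan_rays X) (t : R), 0 <= t /\ q = t *: intmx R (prim (val rho)).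
Proof.
move=> [rho rX]; rewrite -[rho]/(val [` rX]%fset) [X in X _ -> _]fan_ray => -[t t0 qE].
by exists [` rX]%fset, t.
Qed.

Lemma fan_ray_ex : exists rho : fan_rays X, True.
Proof. by have /fset0Pn [rho rX] := fan_nonempty X; exists [` rX]%fset. Qed.

Lemma weightR_gt0 (rho : fan_rays X) : 0 < (weight rho)%:~R :> R.
Proof. by rewrite ltr0z weight_gt0. Qed.

Lemma phi_eq_ray f g (rho : fan_rays X) :
  zval (phi X f) rho = zval (phi X g) rho <->
  feval f (intmx R (prim (val rho))) = feval g (intmx R (prim (val rho))).
Proof.
split=> [e|e]; last by apply: (@er_map_intr_inj R); rewrite !phi_valueE e.
have := phi_valueE f rho; rewrite e phi_valueE => /esym /eqP.
by rewrite eq_le !lee_pmul2l ?lte_fin ?weightR_gt0 // -eq_le => /eqP.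
Qed.

(** Points of the support are nonnegative multiples of primitive directions, so homogeneity reduces
    the right side to these directions, where positive weights cancel. *)
Lemma phi_eqP f g :
  phi X f = phi X g <-> forall q, fan_support X q -> feval f q = feval g q.
Proof.
split=> [e q /fan_supportP [rho [t [t0 ->]]]|e].
  by apply: feval_eqZ => //; apply/phi_eq_ray; rewrite e.
have [rho0 _] := fan_ray_ex; apply: (zval_inj rho0) => rho.
by apply/phi_eq_ray/e/fan_support_prim.
Qed.

Lemma balanced_idot u : \sum_(rho : fan_rays X) weight rho * idot u (prim (val rho)) = 0.
Proof.
rewrite /idot; under eq_bigr => rho _ do rewrite mulr_sumr.
rewrite exchange_big big1 //= => i _.
have /rowP /(_ i) := fan_balanced X; rewrite summxE mxE => e.
transitivity (u 0 i * 0); last by rewrite mulr0.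
rewrite -[in RHS]e mulr_sumr; apply: eq_bigr => rho _.
by rewrite !mxE mulrCA.
Qed.

Lemma phi_unit_monomial f g :
  phi X (f * g) = phi X 1 -> exists u, phi X f = phi X (fmono R u).
Proof.
move=> /phi_eqP fg1.
have [f0 g0] : f != 0 /\ g != 0.
  have [rho _] := fan_ray_ex; have := fg1 _ (fan_support_prim rho).
  by move=> fgd; split; apply/eqP => z; move: fgd; rewrite z ?mul0r ?mulr0 feval0 feval1.
(* Evaluation at [0] only serves to pick some exponent in each support. *)
have [u fu _] := feval_attained 0 f0; have [v gv _] := feval_attained 0 g0.
exists u.
have sum0 (rho : fan_rays X) d : d = intmx R (prim (val rho)) ->
  (feval f d + feval g d)%E = 0%:E.
  by move=> ->; rewrite -fevalM fg1 ?feval1 //; exact: fan_support_prim.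
have le0 (rho : fan_rays X) : idot (u + v) (prim (val rho)) <= 0.
  rewrite -(ler_int R) -dot_int mulr0z -lee_fin -(sum0 rho _ erefl) dotD EFinD.
  by rewrite leeD // feval_ge.
(* Nonpositive numbers whose sum with positive weights is zero all vanish. *)
have eq0 (rho : fan_rays X) : idot (u + v) (prim (val rho)) = 0.
  have /eqP := balanced_idot (u + v).
  rewrite -oppr_eq0 -sumrN psumr_eq0 => [/allP /(_ rho)|r _].
    rewrite mem_index_enum oppr_eq0 mulf_eq0 gt_eqF ?weight_gt0 //=.
    by move=> /(_ isT) /eqP.
  by rewrite oppr_ge0 mulr_ge0_le0 // ltW ?weight_gt0.
have [rho0 _] := fan_ray_ex; apply: (zval_inj rho0) => rho.
apply/phi_eq_ray; set d := intmx R _.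
have := sum0 rho d erefl; have := feval_ge d fu; have := feval_ge d gv.
have : (dot u d + dot v d = 0 :> R) by rewrite -dotD dot_int eq0.
have [u' _ ->] := feval_attained d f0; have [v' _ ->] := feval_attained d g0.
rewrite feval_mono !lee_fin => uv vv uu [uv'].
congr EFin; apply/eqP; rewrite eq_le uu andbT.
(* The sums [u . d + v . d] and [f(d) + g(d)] are both zero, so neither of the bounds
   [u . d <= f(d)] and [v . d <= g(d)] can be strict. *)
by rewrite -(lerD2r (dot v' d)) uv' -uv lerD2l.
Qed.

Lemma zval_phi_mono u (rho : fan_rays X) :
  zval (phi X (fmono R u)) rho = (weight rho * idot u (prim (val rho)))%:E.
Proof.
by apply: (@er_map_intr_inj R); rewrite phi_valueE feval_mono dot_int /= rmorphM.
Qed.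

End FanHomomorphism.

(** * Pullback along linear maps, and rational factors on rays *)

Section Pullback.
Variables (R : realType) (n m : nat) (X : fan R n) (Y : fan R m).

(** This makes the pullback well defined on the image of [phi Y]. *)
Lemma phi_subst_eq (M : 'M[int]_(n, m)) f g :
  (forall x, fan_support X x -> fan_support Y (x *m intmx R M)) ->
  phi Y f = phi Y g -> phi X (fsubst M f) = phi X (fsubst M g).
Proof.
move=> XY /phi_eqP fg; apply/phi_eqP => q Xq.
by rewrite !feval_subst fg //; exact: XY.
Qed.

Lemma restricts_support (mu : fan_support X -> fan_support Y) (M : 'M[int]_(n, m)) :
  restricts mu M -> forall x, fan_support X x -> fan_support Y (x *m intmx R M).
Proof.
move=> muM x Xx; have := muM (SigSub (mem_set Xx)) => /= <-.
exact: set_mem (valP (mu _)).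
Qed.

End Pullback.

Lemma idot_delta n (i : 'I_n) d : idot (delta_mx 0 i) d = d 0 i.
Proof.
rewrite /idot (bigD1 i) //= big1 => [|j ji].
  by rewrite mxE !eqxx mul1r addr0.
by rewrite mxE (negbTE ji) andbF mul0r.
Qed.

Lemma idot_mulmx n m (M : 'M[int]_(n, m)) u d : idot (u *m M^T) d = idot u (d *m M).
Proof.
rewrite /idot; under [RHS]eq_bigr => j _ do rewrite mxE mulr_sumr.
rewrite exchange_big; apply: eq_bigr => i _.
rewrite mxE mulr_suml; apply: eq_bigr => j _.
by rewrite !mxE -mulrA [d 0 i * _]mulrC.
Qed.

(** The factor is a quotient of two integer coordinates, hence rational, as [geometric] demands;
    [e != 0] supplies the denominator. *)
Lemma ray_rational_multiple (R : realType) n (d e : 'rV[int]_n) (t : R) : e != 0 ->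
  0 <= t -> intmx R d = t *: intmx R e ->
  exists2 s : rat, 0 <= s & intmx rat d = s *: intmx rat e.
Proof.
move=> /rV0Pn [i ei] t0 de.
have deE j : (d 0 j)%:~R = t * (e 0 j)%:~R :> R.
  by have /rowP /(_ j) := de; rewrite !mxE.
have ei0 : (e 0 i)%:~R != 0 :> rat by rewrite intr_eq0.
have eiR : (e 0 i)%:~R != 0 :> R by rewrite intr_eq0.
pose s : rat := (d 0 i)%:~R / (e 0 i)%:~R.
have st : ratr s = t :> R by rewrite /s fmorph_div /= !ratr_int deE mulfK.
exists s; first by rewrite -(ler0q R) st.
apply/rowP => j; apply: (@fmorph_inj _ _ (@ratr R)).
by rewrite !mxE rmorphM /= !ratr_int st deE.
Qed.

(** * Existence, functoriality and faithfulness of the pullback *)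

Section Functor.
Variable R : realType.
Implicit Types X Y Z : fan_obj R.

Lemma mu_star_ex X Y (mu : fan_mor X Y) : exists nu, is_mu_star mu nu.
Proof.
have [M muM] := fan_mapP mu.
pose h : {rmorphism fcn R (fan_dim Y) -> hom_image (phi X)} :=
  to_image (phi X) \o fsubst M.
have [|nu nuE] := @image_factor _ _ _ (phi Y) h.
  move=> f g fg; apply: val_inj => /=.
  exact: phi_subst_eq (restricts_support muM) fg.
have geo : geometric (nu : {rmorphism hom_image (phi_obj Y) -> hom_image (phi_obj X)}).
  move=> rho; have := restricts_support muM (fan_support_prim rho).
  move=> /fan_supportP [sigma [t [t0 tE]]].
  have [||s s0 sE] := @ray_rational_multiple R _ (prim (val rho) *m M) (prim (val sigma)) t _ t0.
  - by have [/primitive_neq0] := primP (fan_rational (valP sigma)).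
  - by rewrite map_mxM.
  (* The weights enter since [phi] multiplies coordinates by them: [w_rho (d_rho M)_i = (w_rho s /
     w_sigma) w_sigma (d_sigma)_i]. *)
  exists sigma, ((weight rho)%:~R * s / (weight sigma)%:~R); split.
    by rewrite divr_ge0 ?mulr_ge0 ?ler0z // ltW ?weight_gt0.
  move=> i; rewrite nuE /= [fvar R i]/(fmono R _) fsubst_mono !zval_phi_mono /=.
  rewrite -EFinM idot_mulmx !idot_delta !rmorphM /=; congr EFin.
  have /rowP /(_ i) := sE; rewrite [LHS]mxE [RHS]mxE [in RHS]mxE => ->.
  by rewrite [RHS]mulrA mulfVK ?mulrA // intr_eq0 gt_eqF ?weight_gt0.
(* Any other extension [N] of [mu] agrees with [M] on the support of [X], which is all that [phi X]
   sees. *)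
exists (GeometricMor geo) => N muN f /=; rewrite nuE /=; apply: val_inj => /=.
apply/phi_eqP => q Xq; rewrite !feval_subst.
by have := muN (SigSub (mem_set Xq)); rewrite muM /= => ->.
Qed.

Lemma mu_star_unique X Y (mu : fan_mor X Y) nu nu' :
  is_mu_star mu nu -> is_mu_star mu nu' -> nu = nu'.
Proof.
move=> nuP nuP'; have [M muM] := fan_mapP mu; apply: geometric_mor_ext => y.
by have [f ->] := to_image_surj y; rewrite (nuP M) // (nuP' M).
Qed.

Lemma mu_star_id X : is_mu_star (fan_id X) (geometric_mor_id (phi_obj X)).
Proof.
move=> M MP f; apply: val_inj => /=; apply/phi_eqP => q Xq.
by have := MP (SigSub (mem_set Xq)); rewrite /= feval_subst => <-.
Qed.

Lemma mu_star_comp X Y Z (mu : fan_mor X Y) (mu' : fan_mor Y Z) nu nu' :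
  is_mu_star mu nu -> is_mu_star mu' nu' ->
  is_mu_star (fan_comp mu' mu) (geometric_mor_comp nu nu').
Proof.
move=> nuP nuP' L LP f; have [M muM] := fan_mapP mu.
have [N muN] := fan_mapP mu'.
rewrite /= (nuP' N) // (nuP M) //; apply: val_inj => /=; apply/phi_eqP => q Xq.
rewrite !feval_subst; have := LP (SigSub (mem_set Xq)).
by rewrite /= muN muM /= => ->.
Qed.

(** The pulled back variables are the coordinates of the map, and [phi X] determines them on the
    support. *)
Lemma mu_star_inj X Y (mu mu' : fan_mor X Y) nu :
  is_mu_star mu nu -> is_mu_star mu' nu -> mu = mu'.
Proof.
move=> nuP nuP'; have [M muM] := fan_mapP mu; have [N muN] := fan_mapP mu'.
apply: fan_mor_ext => x; apply: val_inj; rewrite muM muN; apply/rowP => i.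
apply: EFin_inj; rewrite -!feval_var -!feval_subst.
have /phi_eqP : phi X (fsubst M (fvar R i)) = phi X (fsubst N (fvar R i)).
  have e := etrans (esym (nuP M muM (fvar R i))) (nuP' N muN (fvar R i)).
  exact: (congr1 (@image_val _ _ (phi X)) e).
by apply; apply: set_mem; exact: valP.
Qed.

(** * Fullness: recovering a matrix from a homomorphism *)

Lemma image_unit_monomial X (y z : hom_image (phi X)) :
  y * z = 1 -> exists u, y = to_image (phi X) (fmono R u).
Proof.
have [f ->] := to_image_surj y; have [g ->] := to_image_surj z.
rewrite -(rmorphM (to_image (phi X))) -(rmorph1 (to_image (phi X))).
move=> /(congr1 (@image_val _ _ (phi X))).
move=> /phi_unit_monomial [u uE].
by exists u; apply: val_inj; exact: uE.
Qed.

Lemma hom_matrix X Y (nu : {rmorphism hom_image (phi Y) -> hom_image (phi X)}) :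
  exists M, forall f, nu (to_image (phi Y) f) = to_image (phi X) (fsubst M f).
Proof.
have ex j : exists u, nu (to_image (phi Y) (fvar R j)) = to_image (phi X) (fmono R u).
  apply: (@image_unit_monomial _ _ (nu (to_image (phi Y) (fmono R (- delta_mx 0 j))))).
  by rewrite -rmorphM -rmorphM (fmonoV R (delta_mx 0 j)) !rmorph1.
(* The exponents need not be unique when the rays of [X] do not span; any choice works, as only
   pairings with the rays matter. *)
have [u uE] := choice ex.
pose M : 'M[int]_(fan_dim X, fan_dim Y) := \matrix_(i, j) u j 0 i.
have uM j : delta_mx 0 j *m M^T = u j.
  by rewrite -rowE; apply/rowP => i; rewrite !mxE.
exists M.
pose h : {rmorphism fcn R (fan_dim Y) -> hom_image (phi X)} := nu \o to_image (phi Y).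
pose k : {rmorphism fcn R (fan_dim Y) -> hom_image (phi X)} :=
  to_image (phi X) \o fsubst M.
apply: (@fcn_rmorph_ext _ _ _ h k) => j.
by rewrite /= uE [fvar R j]/(fmono R _) fsubst_mono uM.
Qed.

Lemma geometric_support X Y (nu : {rmorphism hom_image (phi Y) -> hom_image (phi X)})
    (M : 'M[int]_(fan_dim X, fan_dim Y)) :
  geometric nu ->
  (forall f, nu (to_image (phi Y) f) = to_image (phi X) (fsubst M f)) ->
  forall x, fan_support X x -> fan_support Y (x *m intmx R M).
Proof.
move=> geo nuE x /fan_supportP [rho [t [t0 ->]]].
have [sigma [s [s0 sE]]] := geo rho.
exists (val sigma); first exact: valP.
rewrite [X in X _]fan_ray.
have wr := weightR_gt0 rho; have ws := weightR_gt0 sigma.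
have sR : 0 <= ratr s :> R by rewrite ler0q.
(* This solves [w_rho (d_rho M)_j = s w_sigma (d_sigma)_j] for [d_rho M] and scales by the position
   [t] on the ray. *)
exists (t * (ratr s * (weight sigma)%:~R / (weight rho)%:~R)).
  exact: mulr_ge0 t0 (divr_ge0 (mulr_ge0 sR (ltW ws)) (ltW wr)).
rewrite -scalemxAl -scalerA; congr (_ *: _); rewrite -map_mxM; apply/rowP => j.
have := sE j; rewrite nuE /= [fvar R j]/(fmono R _) fsubst_mono !zval_phi_mono /=.
rewrite -EFinM idot_mulmx !idot_delta => -[/(congr1 (@ratr R))].
rewrite !rmorphM /= !ratr_int => e.
rewrite [LHS]mxE [RHS]mxE [in RHS]mxE.
apply: (mulfI (lt0r_neq0 wr)).
by rewrite e [RHS]mulrA [X in _ = X * _]mulrC divfK ?lt0r_neq0 // mulrA.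
Qed.

Lemma mu_star_surj X Y (nu : geometric_mor (phi_obj Y) (phi_obj X)) :
  exists mu : fan_mor X Y, is_mu_star mu nu.
Proof.
have [M nuE] := @hom_matrix X Y nu.
have maps := geometric_support (geometric_mapP nu) nuE.
pose mu (x : fan_support X) : fan_support Y :=
  SigSub (mem_set (maps _ (set_mem (valP x)))).
have muP : exists N : 'M[int]_(fan_dim X, fan_dim Y), restricts mu N by exists M.
exists (FanMor muP) => N muN f; rewrite nuE; apply: val_inj => /=.
apply/(phi_eqP X (fsubst M f) (fsubst N f)) => q Xq; rewrite !feval_subst.
by have := muN (SigSub (mem_set Xq)) => /= ->.
Qed.

End Functor.

Theorem theorem1p2 (R : realType) :
  exists mu_star : forall X Y : fan_category R,
      mor X Y -> mor (phi_obj Y : realizable_category R)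
                     (phi_obj X : realizable_category R),
    (forall (X Y : fan_category R) (mu : mor X Y),
       is_mu_star mu (mu_star X Y mu)) /\
    contravariant_functor mu_star /\
    fully_faithful mu_star.
Proof.
(* The pullback is chosen from an existence statement; its uniqueness then yields functoriality and
   one of the two cancellation laws. *)
pose star (X Y : fan_obj R) (mu : fan_mor X Y) := projT1 (cid (mu_star_ex mu)).
have starP X Y mu : is_mu_star mu (@star X Y mu) by rewrite /star; case: cid.
exists star; split; first exact: starP.
split; first split=> [X|X Y Z mu mu'].
- exact (mu_star_unique (starP X X (fan_id X)) (@mu_star_id R X)).
- exact (mu_star_unique (starP X Z (fan_comp mu' mu))
    (@mu_star_comp R X Y Z mu mu' _ _ (starP X Y mu) (starP Y Z mu'))).
move=> X Y; have [inv invP] := choice (@mu_star_surj R X Y).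
exists inv => [mu|nu].
  exact (mu_star_inj (invP (star X Y mu)) (starP X Y mu)).
exact (mu_star_unique (starP X Y (inv nu)) (invP nu)).
Qed.
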